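(* For $n\ge 5$, the welded braid group $WB_n$ is adorable of degree $1$, and for $n=3,4$, $WB_n$ is not adorable.
   Context: The welded braid group $WB_n$ is the group with generators $\sigma_i,\rho_i$ ($1\le i\le n-1$) and the following defining relations (for all indices for which they make sense): braid relations $\sigma_i\sigma_j=\sigma_j\sigma_i$ if $|i-j|>1$, $\sigma_i\sigma_{i+1}\sigma_i=\sigma_{i+1}\sigma_i\sigma_{i+1}$; symmetric relations $\rho_i^2=1$, $\rho_i\rho_j=\rho_j\rho_i$ if $|i-j|>1$, $\rho_i\rho_{i+1}\rho_i=\rho_{i+1}\rho_i\rho_{i+1}$; mixed relations $\sigma_i\rho_j=\rho_j\sigma_i$ if $|i-j|>1$, $\rho_i\rho_{i+1}\sigma_i=\sigma_{i+1}\rho_i\rho_{i+1}$; forbidden relations $\rho_i\sigma_{i+1}\sigma_i=\sigma_{i+1}\sigma_i\rho_{i+1}$. For a group $G$ let $G^0=G$ and $G^i=[G^{i-1},G^{i-1}]$ be the terms of its derived series. $G$ is called adorable if $G^i/G^{i+1}=1$ for some $i\ge 0$; the smallest such $i$ is called the degree of adorability of $G$, and $G$ is then said to be adorable of degree $i$. *)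

(* Defs.v *)
From HB Require Import structures.
From mathcomp Require Import all_boot.
From mathcomp Require Import boolp classical_sets.

Set Implicit Arguments.
Unset Strict Implicit.
Unset Printing Implicit Defensive.

Local Open Scope classical_set_scope.
Local Open Scope group_scope.

Section Presentation.
Variable X : choiceType.

(* (x, false) stands for the generator x and (x, true) for its inverse. *)
Definition letter : Type := (X * bool)%type.
Definition word : Type := seq letter.

Definition gen (x : X) : letter := (x, false).
Definition inv_letter (a : letter) : letter := (a.1, ~~ a.2).
Definition inv_word (w : word) : word := rev (map inv_letter w).

Variable R : word -> word -> Prop.

Inductive pres_eq : word -> word -> Prop :=
| pres_eq_rel u v : R u v -> pres_eq u v
| pres_eq_cancel a : pres_eq [:: a; inv_letter a] [::]
| pres_eq_refl u : pres_eq u u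
| pres_eq_sym u v : pres_eq u v -> pres_eq v u
| pres_eq_trans u v w : pres_eq u v -> pres_eq v w -> pres_eq u w
| pres_eq_cat u u' v v' :
    pres_eq u u' -> pres_eq v v' -> pres_eq (u ++ v) (u' ++ v').

Definition pres_eqb : rel word := fun u v => `[< pres_eq u v >].

Lemma pres_eqb_refl : reflexive pres_eqb.
Proof. by move=> u; apply/asboolP; apply: pres_eq_refl. Qed.

Lemma pres_eqb_sym : symmetric pres_eqb.
Proof. by move=> u v; apply/asboolP/asboolP; apply: pres_eq_sym. Qed.

Lemma pres_eqb_trans : transitive pres_eqb.
Proof.
move=> v u w /asboolP uv /asboolP vw; apply/asboolP.
exact: pres_eq_trans uv vw.
Qed.

Canonical pres_equiv := EquivRel pres_eqb pres_eqb_refl pres_eqb_sym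
  pres_eqb_trans.

Local Open Scope quotient_scope.

(* The group < X | u = v for all u, v such that R u v >. *)
Definition presented : Type := {eq_quot pres_equiv}.
HB.instance Definition _ := Choice.on presented.

Definition pres_class (w : word) : presented := \pi_presented w.

Lemma pres_classP (u v : word) : pres_class u = pres_class v <-> pres_eq u v.
Proof.
by split=> [/eqmodP/asboolP|uv]; last apply/eqmodP/asboolP.
Qed.

Definition pres_one : presented := pres_class [::].
Definition pres_mul (x y : presented) := pres_class (repr x ++ repr y).
Definition pres_inv (x : presented) := pres_class (inv_word (repr x)).

Lemma pres_class_repr (x : presented) : pres_class (repr x) = x.
Proof. exact: reprK. Qed.

Lemma repr_pres_class w : pres_eq (repr (pres_class w)) w.
Proof. by apply/pres_classP; rewrite pres_class_repr. Qed.

Lemma pres_mulE u v :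
  pres_mul (pres_class u) (pres_class v) = pres_class (u ++ v).
Proof. by apply/pres_classP; apply: pres_eq_cat; apply: repr_pres_class. Qed.

Lemma inv_letterK : involutive inv_letter.
Proof. by case=> x b; rewrite /inv_letter /= negbK. Qed.

Lemma inv_wordK : involutive inv_word.
Proof.
by move=> w; rewrite /inv_word map_rev revK -map_comp map_id_in // => a _ /=;
  rewrite inv_letterK.
Qed.

Lemma pres_eq_inv_r w : pres_eq (w ++ inv_word w) [::].
Proof.
elim: w => [|a w IH]; first exact: pres_eq_refl.
have -> : (a :: w) ++ inv_word (a :: w) =
    [:: a] ++ (w ++ inv_word w) ++ [:: inv_letter a].
  by rewrite /inv_word /= rev_cons -cats1 catA.
apply: pres_eq_trans (pres_eq_cancel a).
apply: (pres_eq_cat (pres_eq_refl [:: a])).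
exact: (pres_eq_cat IH (pres_eq_refl [:: inv_letter a])).
Qed.

Lemma pres_mulA : associative pres_mul.
Proof.
move=> x y z; rewrite -(pres_class_repr x) -(pres_class_repr y).
by rewrite -(pres_class_repr z) !pres_mulE catA.
Qed.

Lemma pres_mul1 : left_id pres_one pres_mul.
Proof. by move=> x; rewrite -(pres_class_repr x) pres_mulE. Qed.

Lemma pres_mulr1 : right_id pres_one pres_mul.
Proof. by move=> x; rewrite -(pres_class_repr x) pres_mulE cats0. Qed.

Lemma pres_mulxV : right_inverse pres_one pres_inv pres_mul.
Proof.
move=> x; rewrite -{1}(pres_class_repr x) pres_mulE.
by apply/pres_classP; apply: pres_eq_inv_r.
Qed.

Lemma pres_mulVx : left_inverse pres_one pres_inv pres_mul.
Proof.
move=> x; rewrite -{2}(pres_class_repr x) pres_mulE.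
rewrite -{2}(inv_wordK (repr x)).
by apply/pres_classP; apply: pres_eq_inv_r.
Qed.

HB.instance Definition _ := isGroup.Build presented
  pres_mulA pres_mul1 pres_mulr1 pres_mulVx pres_mulxV.

Definition pres_gen (x : X) : presented := pres_class [:: gen x].

Section Universal.
Variables (H : groupType) (f : X -> H).

Definition letter_eval (a : letter) : H := if a.2 then (f a.1)^-1 else f a.1.
Definition word_eval (w : word) : H := \prod_(a <- w) letter_eval a.

Lemma presented_universal :
  (forall u v, R u v -> word_eval u = word_eval v) ->
  exists! g : presented -> H,
    {morph g : x y / x * y} /\ forall x, g (pres_gen x) = f x.
Proof.
move=> fR.
have evalE u v : pres_eq u v -> word_eval u = word_eval v.
  elim=> {u v} [u v /fR //|[x b]|//|u v _ -> //|u v w _ -> _ -> //|].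
    by rewrite /word_eval !big_cons !big_nil /letter_eval /=;
      case: b => /=; rewrite mulg1 ?mulVg ?mulgV.
  by move=> u u' v v' _ Hu _ Hv; rewrite /word_eval !big_cat /= -!/(word_eval _)
    Hu Hv.
have evalc w : word_eval (repr (pres_class w)) = word_eval w.
  exact/evalE/repr_pres_class.
exists (fun x => word_eval (repr x)); split.
  split=> [x y|x]; last first.
    by rewrite evalc /word_eval big_seq1.
  by rewrite evalc /word_eval big_cat.
move=> g [gM gf]; apply/funext => x.
have g1 : g 1 = 1 by apply: (@mulgI _ (g 1)); rewrite -gM !mulg1.
have gV y : g y^-1 = (g y)^-1.
  by apply: (@mulgI _ (g y)); rewrite -gM !mulgV.
rewrite -{2}(pres_class_repr x); elim: (repr x) => [|[y b] w IH].
  by rewrite /word_eval big_nil.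
rewrite -cat1s -pres_mulE [g _]gM -IH /word_eval big_cat big_seq1.
congr (_ * _); case: b => /=; last exact/esym/gf.
rewrite /letter_eval /= -gf -gV; congr g.
apply: (@mulgI _ (pres_gen y)); rewrite mulgV; apply/esym.
by rewrite [LHS]pres_mulE; apply/pres_classP/(pres_eq_cancel (gen y)).
Qed.

End Universal.
End Presentation.

(* The n - 1 indices are numbered from 0; inl i is sigma_(i + 1) and inr i is
   rho_(i + 1). *)
Definition wb_gen (n : nat) : Type := ('I_n.-1 + 'I_n.-1)%type.
HB.instance Definition _ n := Choice.on (wb_gen n).

Definition sigma n (i : 'I_n.-1) : letter (wb_gen n) := gen (inl i).
Definition rho n (i : 'I_n.-1) : letter (wb_gen n) := gen (inr i).

Definition far n (i j : 'I_n.-1) : bool := (i.+1 < j)%N || (j.+1 < i)%N.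
Definition consecutive n (i j : 'I_n.-1) : bool := j == i.+1 :> nat.

Inductive wb_rel (n : nat) : word (wb_gen n) -> word (wb_gen n) -> Prop :=
| braid_comm i j : far i j ->
    wb_rel [:: sigma i; sigma j] [:: sigma j; sigma i]
| braid_braid i j : consecutive i j ->
    wb_rel [:: sigma i; sigma j; sigma i] [:: sigma j; sigma i; sigma j]
| sym_square i :
    wb_rel [:: rho i; rho i] [::]
| sym_comm i j : far i j ->
    wb_rel [:: rho i; rho j] [:: rho j; rho i]
| sym_braid i j : consecutive i j ->
    wb_rel [:: rho i; rho j; rho i] [:: rho j; rho i; rho j]
| mixed_comm i j : far i j ->
    wb_rel [:: sigma i; rho j] [:: rho j; sigma i]
| mixed_braid i j : consecutive i j ->
    wb_rel [:: rho i; rho j; sigma i] [:: sigma j; rho i; rho j]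
| forbidden i j : consecutive i j ->
    wb_rel [:: rho i; sigma j; sigma i] [:: sigma j; sigma i; rho j].

Definition welded_braid (n : nat) : groupType := presented (@wb_rel n).

Section Adorable.
Variable G : groupType.
Implicit Types A B H K : set G.

Definition subgroup H : Prop := H 1 /\ forall x y, H x -> H y -> H (x / y).

Definition generated A : set G := smallest subgroup A.

Definition commutator_subgroup A B : set G :=
  generated [set [~ x, y] | x in A & y in B].

Fixpoint derived (i : nat) : set G :=
  if i is j.+1 then commutator_subgroup (derived j) (derived j) else setT.

Definition left_coset (x : G) K : set G := [set x * k | k in K].

Definition quotient_set H K : set (set G) := [set left_coset x K | x in H].

(* The quotient H / K is trivial: its only element is the identity coset K. *)
Definition trivial_quotient H K : Prop := quotient_set H K = [set K].

Definition adorable : Prop :=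
  exists i, trivial_quotient (derived i) (derived i.+1).

Definition adorable_of_degree (d : nat) : Prop :=
  trivial_quotient (derived d) (derived d.+1) /\
  forall i, trivial_quotient (derived i) (derived i.+1) -> (d <= i)%N.

End Adorable.

(* Main.v *)
From mathcomp Require Import all_boot all_fingroup all_algebra all_solvable.
From mathcomp Require Import integral_char boolp classical_sets zify ring.
From mathcomp Require Import generic_quotient.
Require Import Defs.

(** Write D i for the derived series of WB_n.

    For n >= 5 the point is that D 1 is contained in D 2.  The braid relation
    makes consecutive generators sigma_i, sigma_j conjugate, so all sigma's
    agree modulo D 1.  If sigma_k commutes with both sigma_i and sigma_j, then
    [sigma_i, sigma_j] = [sigma_k^-1 sigma_i, sigma_k^-1 sigma_j] is a
    commutator of two elements of D 1, hence lies in D 2.  With five strands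
    such a k exists for enough consecutive pairs i, j.  Two elements that
    satisfy the braid relation and commute modulo D 2 are equal modulo D 2, so
    all sigma's agree modulo D 2 (eqmod_derived2), and so do all rho's.  As some sigma commutes with some
    rho, WB_n is abelian modulo D 2.  On the other hand D 1 is not D 0, because
    the generators map to odd permutations.

    For n = 3 and n = 4 the witness is the Burau representation at t = -1,
    extended to the rho's by permuting coordinates: a linear action of WB_n
    over the integers.  Let Gamma m be the subgroup that acts trivially modulo
    m.

    - The commutator of two elements of Gamma m is in Gamma (m ^ 2)
      (congruenceR).  Modulo 2 the action is the permutation action of S_n,
      which is solvable since n! has at most two prime factors.  So some D i
      is contained in Gamma 2, the later terms are in Gamma (2 ^ 2 ^ k) with k
      arbitrarily large, and if the derived series became stationary, its
      final term would act trivially.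

    - Modulo 5 the braids on three strands act, in the reduced representation,
      through SL_2(F_5), which is not solvable.  Concretely,
      s = sigma_2^-1 sigma_1 is, modulo Gamma 5, a commutator of two conjugates
      of itself (eqmod5_commg).  Hence every term of the derived series meets
      the coset of s modulo Gamma 5, which does not contain the identity.

    The two facts are incompatible with D i = D i.+1. *)

Set Implicit Arguments.
Unset Strict Implicit.
Unset Printing Implicit Defensive.

Local Open Scope classical_set_scope.
Local Open Scope group_scope.

(** * The derived series of an abstract group *)

Section DerivedSeries.
Variable G : groupType.
Local Notation D := (@derived G).
Implicit Types (A B N : set G) (x y : G).

Lemma subgroupM N x y : subgroup N -> N x -> N y -> N (x * y).
Proof.
by move=> [N1 Nd] Nx Ny; rewrite -[y]invgK -[y^-1]div1g; apply/Nd/Nd.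
Qed.

Lemma subgroupV N x : subgroup N -> N x -> N x^-1.
Proof. by move=> [N1 Nd] Nx; rewrite -div1g; apply: Nd. Qed.

Definition normal_subgroup N := subgroup N /\ forall x y, N x -> N (x ^ y).

Lemma generated_subgroup A : subgroup (generated A).
Proof.
split=> [B [[B1 _] _] //|x y Gx Gy B [sB AB]].
by apply: sB.2; [apply: Gx | apply: Gy].
Qed.

Lemma sub_generated A : A `<=` generated A.
Proof. by move=> x Ax B [_ AB]; apply: AB. Qed.

Lemma generated_min A N : subgroup N -> A `<=` N -> generated A `<=` N.
Proof. by move=> sN AN x; apply. Qed.

Lemma derived_normal i : normal_subgroup (D i).
Proof.
elim: i => [|i [sD nD]]; first by [].
split=> [|x y Dx]; first exact: generated_subgroup.
move: x Dx; apply: (generated_min (N := [set x | D i.+1 (x ^ y)])).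
  split=> [|u v] /=; first by rewrite conj1g; apply: (generated_subgroup _).1.
  by move=> Du Dv; rewrite conjMg conjVg; apply: (generated_subgroup _).2.
move=> _ [u Du [v Dv <-]] /=; rewrite conjRg; apply: sub_generated.
by exists (u ^ y); [apply: nD | exists (v ^ y) => //; apply: nD].
Qed.

Lemma derived_subgroup i : subgroup (D i).
Proof. by have [] := derived_normal i. Qed.

Lemma derivedR i x y : D i x -> D i y -> D i.+1 [~ x, y].
Proof. by move=> Dx Dy; apply: sub_generated; exists x => //; exists y. Qed.

Lemma derivedS_min i N : subgroup N ->
  (forall x y, D i x -> D i y -> N [~ x, y]) -> D i.+1 `<=` N.
Proof.
by move=> sN NR; apply: generated_min => // _ [x Dx [y Dy <-]]; apply: NR.
Qed.

Lemma derivedS_sub i : D i.+1 `<=` D i.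
Proof.
have sD := derived_subgroup i; apply: derivedS_min => // x y Dx Dy.
by apply: subgroupM => //; [apply: subgroupV | apply: (derived_normal i).2].
Qed.

Lemma derived_anti i j : (i <= j)%N -> D j `<=` D i.
Proof.
move/subnK <-; elim: (j - i)%N => [|k IH] //.
exact: subset_trans (@derivedS_sub _) IH.
Qed.

Lemma trivial_quotientP i :
  trivial_quotient (D i) (D i.+1) <-> D i `<=` D i.+1.
Proof.
have sD := derived_subgroup i.+1.
split=> [tq x Dx|DD].
  have: quotient_set (D i) (D i.+1) (left_coset x (D i.+1)) by exists x.
  rewrite tq => <-; exists 1; first exact: sD.1.
  exact: mulg1.
rewrite /trivial_quotient; apply/seteqP; split=> [_ [x /DD Dx <-]|_ ->] /=.
  apply/seteqP; split=> [_ [y Dy <-]|y Dy]; first exact: (subgroupM sD).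
  exists (x^-1 * y); last exact: mulVKg.
  exact: (subgroupM sD (subgroupV sD Dx) Dy).
exists 1; first exact: (derived_subgroup i).1.
apply/seteqP; split=> [_ [y Dy <-]|y Dy]; first by rewrite mul1g.
by exists y; rewrite ?mul1g.
Qed.

Lemma derived_stable i k : D i `<=` D i.+1 -> D i `<=` D (k + i).
Proof.
move=> DD; elim: k => [|k IH] //; apply: subset_trans IH _.
elim: k => [|k IH] //; apply: derivedS_min; first exact: derived_subgroup.
by move=> x y /IH Dx /IH Dy; apply: derivedR.
Qed.
End DerivedSeries.

(** * Congruence modulo a normal subgroup *)

Section Congruence.
Variables (G : groupType) (N : set G).
Implicit Types (x y s : G).
Hypothesis nN : normal_subgroup N.
Let sN : subgroup N := nN.1.

Definition eqmod x y := N (x^-1 * y).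

Lemma eqmod_refl x : eqmod x x.
Proof. by rewrite /eqmod mulVg; apply: sN.1. Qed.

Lemma eqmod_sym x y : eqmod x y -> eqmod y x.
Proof. by move/(subgroupV sN); rewrite invgM invgK. Qed.

Lemma eqmod_trans y x z : eqmod x y -> eqmod y z -> eqmod x z.
Proof.
by move=> xy yz; rewrite /eqmod -[z](mulVKg y) mulgA; apply: subgroupM.
Qed.

Lemma eqmodM x x' y y' : eqmod x x' -> eqmod y y' -> eqmod (x * y) (x' * y').
Proof.
move=> xx yy; rewrite /eqmod invgM.
have ->: y^-1 * x^-1 * (x' * y') = (x^-1 * x') ^ y * (y^-1 * y').
  by rewrite conjgE !mulgA mulgK.
by apply: subgroupM => //; apply: nN.2.
Qed.

Lemma eqmodV x x' : eqmod x x' -> eqmod x^-1 x'^-1.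
Proof.
move=> xx; rewrite /eqmod invgK.
have -> : x * x'^-1 = (x'^-1 * x) ^ x'^-1.
  by rewrite conjgE invgK !mulgA mulgV mul1g.
by apply: nN.2; apply: eqmod_sym.
Qed.

Lemma eqmodJ z x x' : eqmod x x' -> eqmod (x ^ z) (x' ^ z).
Proof. by move=> xx; do !apply: eqmodM => //; apply: eqmod_refl. Qed.

Lemma eqmodR x x' y y' : eqmod x x' -> eqmod y y' -> eqmod [~ x, y] [~ x', y'].
Proof. by move=> xx yy; do !apply: eqmodM => //; apply: eqmodV. Qed.

Lemma eqmod_commute x y : eqmod (x * y) (y * x) <-> N [~ x, y].
Proof.
split=> [/eqmod_sym|xy].
  by rewrite /eqmod invgM /commg conjgE !mulgA.
by apply: eqmod_sym; rewrite /eqmod invgM -mulgA.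
Qed.

Lemma commute_eqmod x x' y y' :
  eqmod x x' -> eqmod y y' -> commute x' y' -> N [~ x, y].
Proof.
move=> xx yy /commgP/eqP xy; rewrite -[[~ _, _]]mul1g -invg1 -xy.
by apply: eqmodR; apply: eqmod_sym.
Qed.

Lemma centralizer_mod_subgroup y : subgroup [set x | N [~ x, y]].
Proof.
(* N [~ x, y] is eqmod x (x ^ y), and x |-> x ^ y is an endomorphism. *)
split=> [|x z Nx Nz] /=; first by rewrite comm1g; apply: sN.1.
by rewrite -/(eqmod _ _) conjMg conjVg; apply: eqmodM => //; apply: eqmodV.
Qed.

(** If an element is, modulo N, a commutator of two of its own conjugates, its
    coset survives in the whole derived series, as the terms of the series are
    normal. *)
Lemma derived_meets_coset s a b : eqmod s [~ s ^ a, s ^ b] ->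
  forall i, exists2 x, derived i x & eqmod s x.
Proof.
move=> sE; elim=> [|i [x Dx sx]]; first by exists s => //; apply: eqmod_refl.
exists [~ x ^ a, x ^ b].
  by apply: derivedR; apply: (derived_normal G i).2.
by apply: eqmod_trans sE _; apply: eqmodR; apply: eqmodJ.
Qed.

End Congruence.

(** * Groups given by a presentation *)

Section Presented.
Variables (X : choiceType) (R : word X -> word X -> Prop).
Local Notation G := (presented R).

Lemma pres_class_cat u v :
  pres_class R (u ++ v) = pres_class R u * pres_class R v.
Proof. by rewrite [RHS]pres_mulE. Qed.

Lemma pres_genV x : (pres_gen R x)^-1 = pres_class R [:: inv_letter (gen x)].
Proof.
apply: (@mulgI _ (pres_gen R x)); rewrite mulgV -pres_class_cat.
exact/esym/pres_classP/(pres_eq_cancel R (gen x)).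
Qed.

Lemma generators_full (N : set G) : subgroup N ->
  (forall x, N (pres_gen R x)) -> forall x, N x.
Proof.
move=> sN Ngen x; rewrite -(pres_class_repr x).
elim: (repr x) => [|[y b] w IH]; first exact: sN.1.
rewrite -cat1s pres_class_cat; apply: subgroupM => //.
case: b; last exact: Ngen.
by rewrite -[[:: _]]/[:: inv_letter (gen y)] -pres_genV; apply: subgroupV.
Qed.

Section Action.
Variables (T : Type) (act : letter X -> T -> T).
Hypothesis actK : forall a t, act a (act (inv_letter a) t) = t.
Hypothesis act_rel :
  forall u v, R u v -> forall t, foldr act t u = foldr act t v.

Lemma foldr_pres_eq u v :
  pres_eq R u v -> forall t, foldr act t u = foldr act t v.
Proof.
elim=> {u v} [u v /act_rel //|a t|//|u v _ uv t|u v w _ uv _ vw t|].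
- exact: actK.
- by rewrite uv.
- by rewrite uv.
by move=> u u' v v' _ uu' _ vv' t; rewrite !foldr_cat vv' uu'.
Qed.

Definition pres_act (x : G) (t : T) : T := foldr act t (repr x).

Lemma pres_act_class w t : pres_act (pres_class R w) t = foldr act t w.
Proof. exact/foldr_pres_eq/repr_pres_class. Qed.

Lemma pres_act1 t : pres_act 1 t = t.
Proof. exact: pres_act_class. Qed.

Lemma pres_actM x y t : pres_act (x * y) t = pres_act x (pres_act y t).
Proof.
rewrite -{1}(pres_class_repr x) -{1}(pres_class_repr y) -pres_class_cat.
by rewrite pres_act_class foldr_cat.
Qed.

End Action.
End Presented.

Section AbelianizationModulo.
Variables (X : choiceType) (R : word X -> word X -> Prop).
Variable N : set (presented R).
Hypothesis nN : normal_subgroup N.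

Lemma generators_commute_mod :
  (forall x y, N [~ pres_gen R x, pres_gen R y]) -> forall x y, N [~ x, y].
Proof.
move=> Ngen x y; move: x; apply: generators_full.
  exact: centralizer_mod_subgroup.
move=> x; rewrite -invgR; apply: (subgroupV nN.1); move: y.
by apply: generators_full => //; apply: centralizer_mod_subgroup.
Qed.
End AbelianizationModulo.

(** * Families of braid generators on at least five strands *)

Section Braids.
Variable G : groupType.
Implicit Types (N : set G) (x y c : G).

Lemma braid_conj x y : x * y * x = y * x * y -> y = x ^ (y * x).
Proof. by move=> xyx; rewrite conjgE [x * _]mulgA xyx mulKg. Qed.

Lemma braid_eqmod_derived1 x y :
  x * y * x = y * x * y -> eqmod (derived 1) x y.
Proof. by move/braid_conj=> ->; apply: (@derivedR _ 0). Qed.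

(** When x and y commute modulo N, the braid relation reads
    y x x = y x y modulo N, and y x cancels. *)
Lemma commuting_braid_eqmod N x y : normal_subgroup N ->
  x * y * x = y * x * y -> N [~ x, y] -> eqmod N x y.
Proof.
move=> nN xyx /(eqmod_commute nN) xy.
rewrite -[x](mulKg (y * x)) -[y in eqmod _ _ y](mulKg (y * x)).
apply: eqmodM => //; first exact: eqmod_refl.
by rewrite -xyx; apply/(eqmod_sym nN)/(eqmodM nN) => //; apply: eqmod_refl.
Qed.

(** The device that turns a commutator of generators into a commutator of
    elements of the derived subgroup: c is another generator, so that c^-1 * x
    and c^-1 * y have trivial image in the abelianization. *)
Lemma commg_mulV2 c x y : commute c x -> commute c y ->
  [~ c^-1 * x, c^-1 * y] = [~ x, y].
Proof.
move=> cx cy; have cyx : commute c (y^-1 * x) by apply/commuteM/cx/commuteV.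
rewrite /commg /conjg !invgM !invgK -!mulgA mulVKg; congr (_ * _).
have -> : c * (y^-1 * (x * (c^-1 * y))) = c * (y^-1 * x) * (c^-1 * y).
  by rewrite !mulgA.
by rewrite cyx -!mulgA mulVKg.
Qed.
End Braids.

Section GeneratorFamily.
Variables (n : nat) (G : groupType) (a : 'I_n.-1 -> G).
Hypothesis a_far : forall i j, far i j -> commute (a i) (a j).
Hypothesis a_braid : forall i j, consecutive i j ->
  a i * a j * a i = a j * a i * a j.

Lemma eqmod_connected (N : set G) : normal_subgroup N ->
  (forall i j, consecutive i j -> eqmod N (a i) (a j)) ->
  forall i j, eqmod N (a i) (a j).
Proof.
move=> nN step.
suff key k (i j : 'I_n.-1) : (k + i)%N = j -> eqmod N (a i) (a j).
  move=> i j; case/orP: (leq_total i j) => /subnK; first exact: key.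
  by move/key; apply: eqmod_sym.
elim: k j => [|k IH] j ij.
  by have -> : i = j; [apply: val_inj | exact: eqmod_refl].
have lt_ki : (k + i < n.-1)%N by rewrite (leq_trans _ (ltn_ord j)) // -ij.
apply: (eqmod_trans nN (IH (Ordinal lt_ki) erefl)).
by apply: step; rewrite /consecutive -ij.
Qed.

Lemma eqmod_derived1 i j : eqmod (derived 1) (a i) (a j).
Proof.
apply: eqmod_connected => [|{}i {}j /a_braid]; first exact: derived_normal.
exact: braid_eqmod_derived1.
Qed.

Lemma derived2_commg i j k : far k i -> far k j -> derived 2 [~ a i, a j].
Proof.
move=> ki kj; rewrite -(@commg_mulV2 _ (a k)); try exact: a_far.
by apply: derivedR; apply: eqmod_derived1.
Qed.

(** Indices 0 and 3 serve as the auxiliary generator of derived2_commg for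
    every consecutive pair except (1, 2): on five strands no generator is far
    from both of these.  That pair follows from (0, 1), since a 0 commutes with
    a 2 and equals a 1 modulo the second derived subgroup. *)
Lemma eqmod_derived2 i j : (5 <= n)%N -> eqmod (derived 2) (a i) (a j).
Proof.
move=> n_ge5; have nD := derived_normal G 2.
have [lt0 lt3] : (0 < n.-1)%N /\ (3 < n.-1)%N by split; lia.
pose o0 := Ordinal lt0; pose o3 := Ordinal lt3.
have step_ne1 k l : consecutive k l -> k != 1%N :> nat ->
    eqmod (derived 2) (a k) (a l).
  move=> kl k1; apply: (commuting_braid_eqmod nD (a_braid kl)).
  move: kl => /eqP kl; case: (posnP k) => [k0|k_gt0].
    by apply: (@derived2_commg _ _ o3); rewrite /far /= ?kl k0.
  by apply: (@derived2_commg _ _ o0); rewrite /far /= ?kl; lia.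
apply: eqmod_connected => // {}i {}j ij.
have [i1|] := eqVneq (i : nat) 1%N; last exact: step_ne1.
apply: (commuting_braid_eqmod nD (a_braid ij)).
have io0 : eqmod (derived 2) (a i) (a o0).
  by apply: (eqmod_sym nD); apply: step_ne1; rewrite /consecutive ?i1.
apply: (commute_eqmod nD io0 (eqmod_refl nD _)).
by apply: a_far; rewrite /far (eqP ij) i1.
Qed.
End GeneratorFamily.

(** * Generators of the welded braid group *)

Section WeldedBraids.
Variable n : nat.
Local Notation WB := (welded_braid n).

Definition sigma_elt (i : 'I_n.-1) : WB := pres_gen (@wb_rel n) (inl i).
Definition rho_elt (i : 'I_n.-1) : WB := pres_gen (@wb_rel n) (inr i).

Local Notation cls := (pres_class (@wb_rel n)).

Lemma wb_relE u v : wb_rel u v -> cls u = cls v.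
Proof. by move=> uv; apply/pres_classP/pres_eq_rel. Qed.

Lemma cls2 a b : cls [:: a; b] = cls [:: a] * cls [:: b].
Proof. by rewrite -pres_class_cat. Qed.

Lemma cls3 a b c : cls [:: a; b; c] = cls [:: a] * cls [:: b] * cls [:: c].
Proof. by rewrite -!pres_class_cat. Qed.

Lemma sigma_far i j : far i j -> commute (sigma_elt i) (sigma_elt j).
Proof. by move=> ij; have := wb_relE (braid_comm ij); rewrite !cls2. Qed.

Lemma rho_far i j : far i j -> commute (rho_elt i) (rho_elt j).
Proof. by move=> ij; have := wb_relE (sym_comm ij); rewrite !cls2. Qed.

Lemma sigma_rho_far i j : far i j -> commute (sigma_elt i) (rho_elt j).
Proof. by move=> ij; have := wb_relE (mixed_comm ij); rewrite !cls2. Qed.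

Lemma sigma_braid i j : consecutive i j ->
  sigma_elt i * sigma_elt j * sigma_elt i =
  sigma_elt j * sigma_elt i * sigma_elt j.
Proof. by move=> ij; have := wb_relE (braid_braid ij); rewrite !cls3. Qed.

Lemma rho_braid i j : consecutive i j ->
  rho_elt i * rho_elt j * rho_elt i =
  rho_elt j * rho_elt i * rho_elt j.
Proof. by move=> ij; have := wb_relE (sym_braid ij); rewrite !cls3. Qed.

Section Strands.
Implicit Types i j k : 'I_n.-1.

Lemma lstrand_proof i : (i < n)%N.
Proof. by have := ltn_ord i; lia. Qed.
Definition lstrand i := Ordinal (lstrand_proof i).

Lemma rstrand_proof i : (i.+1 < n)%N.
Proof. by have := ltn_ord i; lia. Qed.
Definition rstrand i := Ordinal (rstrand_proof i).
End Strands.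

Lemma rstrand_consecutive i j : consecutive i j -> rstrand i = lstrand j.
Proof. by move=> /eqP ij; apply: val_inj; rewrite /= ij. Qed.

Lemma lstrand_neq_rstrand i : lstrand i != rstrand i.
Proof. by rewrite -val_eqE /=; lia. Qed.

Lemma far_strands i j : far i j ->
  [/\ lstrand i != lstrand j, lstrand i != rstrand j,
      rstrand i != lstrand j & rstrand i != rstrand j].
Proof. by rewrite /far -!val_eqE /=; split; lia. Qed.

Lemma consecutive_strands i j : consecutive i j ->
  [/\ lstrand i != lstrand j, lstrand i != rstrand j
    & lstrand j != rstrand j].
Proof. by rewrite /consecutive -!val_eqE /=; split; lia. Qed.

End WeldedBraids.

(** * Five strands or more: the derived subgroup is perfect *)

Lemma derived1_perfect n : (5 <= n)%N ->
  derived (G := welded_braid n) 1 `<=` derived (G := welded_braid n) 2.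
Proof.
move=> n_ge5; set D2 := derived 2.
have nD : normal_subgroup D2 by apply: derived_normal.
have [lt0 lt3] : (0 < n.-1)%N /\ (3 < n.-1)%N by split; lia.
have sigma_eq i j : eqmod D2 (sigma_elt i) (sigma_elt j).
  by apply: eqmod_derived2 => // ? ?; [apply: sigma_far | apply: sigma_braid].
have rho_eq i j : eqmod D2 (rho_elt i) (rho_elt j).
  by apply: eqmod_derived2 => // ? ?; [apply: rho_far | apply: rho_braid].
have sigma_rho i j : D2 [~ sigma_elt i, rho_elt j].
  have far03 : far (Ordinal lt0) (Ordinal lt3) by [].
  apply: (commute_eqmod nD (sigma_eq i (Ordinal lt0)) (rho_eq j (Ordinal lt3))).
  exact: sigma_rho_far.
suff comm x y : D2 [~ x, y] by apply: derivedS_min => //; apply: nD.1.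
move: x y; apply: generators_commute_mod => // -[i|i] [j|j].
- exact: (commute_eqmod nD (sigma_eq i j) (sigma_eq j j) (commute_refl _)).
- exact: sigma_rho.
- by rewrite -invgR; apply: (subgroupV nD.1); apply: sigma_rho.
- exact: (commute_eqmod nD (rho_eq i j) (rho_eq j j) (commute_refl _)).
Qed.

(** * The quotient onto the symmetric group *)

Section FiniteQuotient.
Variables (G : groupType) (gT : finGroupType) (f : G -> gT).
Hypothesis fM : {morph f : x y / x * y}.

Lemma morphM1 : f 1 = 1.
Proof. by apply: (@mulgI _ (f 1)); rewrite -fM !mulg1. Qed.

Lemma morphMV x : f x^-1 = (f x)^-1.
Proof. by apply: (@mulgI _ (f x)); rewrite -fM !mulgV morphM1. Qed.

Lemma morphMR x y : f [~ x, y] = [~ f x, f y].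
Proof. by rewrite /commg /conjg !fM !morphMV. Qed.

Lemma preim_subgroup (A : {group gT}) : subgroup [set x | f x \in A].
Proof.
split=> [|x y fx fy] /=; first by rewrite morphM1 group1.
by rewrite fM morphMV groupM ?groupV.
Qed.

Lemma derived_morph i : @derived G i `<=` [set x | f x \in ([set: gT]^`(i))%G].
Proof.
elim: i => [x _|i IH] /=; first by rewrite inE.
apply: derivedS_min => [|x y /IH fx /IH fy]; first exact: preim_subgroup.
by rewrite /= morphMR dergSn mem_commg.
Qed.

Lemma derived_solvable_quotient : solvable [set: gT]%G ->
  exists i, forall x, @derived G i x -> f x = 1.
Proof.
case/derivedP=> i sub1; exists i => x /derived_morph fx.
by move: fx; rewrite /= sub1 => /set1gP.
Qed.
End FiniteQuotient.

(** For n <= 4 only the primes 2 and 3 divide n!, so Burnside's p^a q^b theorem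
    applies. *)
Lemma Sym_solvable n : (n <= 4)%N -> solvable [set: 'S_n]%G.
Proof.
move=> n_le4; apply: Burnside_p_a_q_b; rewrite cardsT card_Sn.
by case: n n_le4 => [|[|[|[|[|]]]]].
Qed.

Lemma tperm_braid (T : finType) (p q r : T) : p != q -> p != r -> q != r ->
  tperm p q * tperm q r * tperm p q = tperm q r * tperm p q * tperm q r.
Proof.
move=> pq pr qr; have conj (s t : {perm T}) : s^-1 = s -> s * t * s = t ^ s.
  by move=> sV; rewrite conjgE sV mulgA.
rewrite !conj ?tpermV // !tpermJ tpermR tpermL.
by rewrite (tpermD pr qr) (@tpermD _ q r p) // eq_sym.
Qed.

Lemma tperm_commute (T : finType) (p q r s : T) :
   p != r -> p != s -> q != r -> q != s -> commute (tperm p q) (tperm r s).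
Proof.
move=> pr ps qr qs; apply/commgP/conjg_fixP.
by rewrite tpermJ !tpermD // eq_sym.
Qed.

Section StrandPermutation.
Variable n : nat.
Local Notation WB := (welded_braid n).

Definition strand_tperm (i : 'I_n.-1) : 'S_n := tperm (lstrand i) (rstrand i).

Definition strand_swap (x : wb_gen n) : 'S_n :=
  match x with inl i | inr i => strand_tperm i end.

Lemma exists_strand_perm : exists f : WB -> 'S_n, {morph f : x y / x * y} /\
  forall x, f (pres_gen (@wb_rel n) x) = strand_swap x.
Proof.
have [|f [fP _]] := presented_universal (R := @wb_rel n) (f := strand_swap);
  last by exists f.
have comm i j : far i j ->
    strand_tperm i * strand_tperm j = strand_tperm j * strand_tperm i.
  by case/far_strands; apply: tperm_commute.
have braid i j : consecutive i j ->
    strand_tperm i * (strand_tperm j * strand_tperm i) =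
    strand_tperm j * (strand_tperm i * strand_tperm j).
  move=> ij; have [? ? ?] := consecutive_strands ij.
  by rewrite /strand_tperm (rstrand_consecutive ij) !mulgA; apply: tperm_braid.
(* Forgetting which letters are sigma's, every relation but the square of
   rho is a commutation or a braid relation. *)
move=> u v; rewrite /word_eval.
by case=> [i j /comm|i j /braid|i|i j /comm|i j /braid|i j /comm|i j /braid|
    i j /braid]; rewrite !big_cons !big_nil /letter_eval /= !mulg1 ?tperm2.
Qed.
End StrandPermutation.

(** The sign of the strand permutation is trivial on commutators, but not on
    generators. *)
Lemma derived0_proper n : (2 <= n)%N ->
  ~ derived (G := welded_braid n) 0 `<=` derived (G := welded_braid n) 1.
Proof.
move=> n_ge2 D01; have [f [fM fgen]] := exists_strand_perm n.
have lt0 : (0 < n.-1)%N by lia.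
have even x : derived 1 x -> ~~ odd_perm (f x).
  apply: (derivedS_min (N := [set x | ~~ odd_perm (f x)])) x => [|x y _ _] /=.
    split=> [|x y /= fx fy]; first by rewrite /= (morphM1 fM) odd_perm1.
    by rewrite fM (morphMV fM) odd_permM odd_permV (negPf fx).
  by rewrite (morphMR fM) odd_permM odd_permJ odd_permV addbb.
have := even (sigma_elt (Ordinal lt0)) (D01 _ I).
by rewrite fgen odd_tperm lstrand_neq_rstrand.
Qed.

(** * The Burau action at t = -1 *)

Section Burau.
Variable T : finType.
Local Open Scope ring_scope.
Import GRing.Theory.
Implicit Types (p q r : T) (v w : {ffun T -> int}).

(** On the pair of coordinates (p, q) this is the matrix with rows (2, -1) and
    (1, 0): the Burau block with rows (1 - t, t) and (1, 0) at t = -1, which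
    reduces to a transposition modulo 2. *)
Definition burau p q v : {ffun T -> int} :=
  [ffun k => if k == p then v p *+ 2 - v q else if k == q then v p else v k].

Definition burauV p q v : {ffun T -> int} :=
  [ffun k => if k == p then v q else if k == q then v q *+ 2 - v p else v k].

Definition swap p q v : {ffun T -> int} :=
  [ffun k => if k == p then v q else if k == q then v p else v k].

(* Compares two vectors at each coordinate, according to which of the given
   strands the coordinate is. *)
Ltac by_coordinates :=
  repeat match goal with H : is_true (?a != ?b) |- _ =>
    lazymatch goal with _ : a <> b |- _ => fail | _ => have ? := elimN eqP H end
  end;
  let k := fresh "k" in apply/ffunP => k; rewrite !ffunE;
  repeat match goal with |- context [?x == ?y] => case: (@eqP _ x y) => ? end;
  subst; try congruence; try ring.

Lemma burauK p q : p != q -> cancel (burauV p q) (burau p q).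
Proof. move=> pq v; by_coordinates. Qed.

Lemma burauVK p q : p != q -> cancel (burau p q) (burauV p q).
Proof. move=> pq v; by_coordinates. Qed.

Lemma swapK p q : p != q -> involutive (swap p q).
Proof. move=> pq v; by_coordinates. Qed.

Section Disjoint.
Variables (p q r s : T).
Hypotheses (pr : p != r) (ps : p != s) (qr : q != r) (qs : q != s).

Lemma burau_burau_disjoint v :
  burau p q (burau r s v) = burau r s (burau p q v).
Proof. by_coordinates. Qed.

Lemma swap_swap_disjoint v : swap p q (swap r s v) = swap r s (swap p q v).
Proof. by_coordinates. Qed.

Lemma burau_swap_disjoint v : burau p q (swap r s v) = swap r s (burau p q v).
Proof. by_coordinates. Qed.
End Disjoint.

Section ThreeStrands.
Variables (p q r : T).

(** Normal form of a vector for computing with braids on the strands p, q, r: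
    its three entries there, and v elsewhere. *)
Definition coords (a b c : int) v : {ffun T -> int} :=
  [ffun k => if k == p then a else if k == q then b
             else if k == r then c else v k].

Lemma coordsE v : v = coords (v p) (v q) (v r) v.
Proof. by_coordinates. Qed.

Hypotheses (pq : p != q) (pr : p != r) (qr : q != r).

Lemma burau_braid v :
  burau p q (burau q r (burau p q v)) = burau q r (burau p q (burau q r v)).
Proof. by_coordinates. Qed.

Lemma swap_braid v :
  swap p q (swap q r (swap p q v)) = swap q r (swap p q (swap q r v)).
Proof. by_coordinates. Qed.

Lemma swap_swap_burau v :
  swap p q (swap q r (burau p q v)) = burau q r (swap p q (swap q r v)).
Proof. by_coordinates. Qed.

Lemma swap_burau_burau v :
  swap p q (burau q r (burau p q v)) = burau q r (burau p q (swap q r v)).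
Proof. by_coordinates. Qed.

Lemma burau_coords12 a b c v :
  burau p q (coords a b c v) = coords (a *+ 2 - b) a c v.
Proof. by_coordinates. Qed.

Lemma burau_coords23 a b c v :
  burau q r (coords a b c v) = coords a (b *+ 2 - c) b v.
Proof. by_coordinates. Qed.

Lemma burauV_coords12 a b c v :
  burauV p q (coords a b c v) = coords b (b *+ 2 - a) c v.
Proof. by_coordinates. Qed.

Lemma burauV_coords23 a b c v :
  burauV q r (coords a b c v) = coords a c (c *+ 2 - b) v.
Proof. by_coordinates. Qed.

End ThreeStrands.
End Burau.

(** * Three or four strands: congruence subgroups of the Burau representation *)

Section BurauRepresentation.
Variable n : nat.
Local Notation WB := (welded_braid n).
Local Notation D := (@derived WB).
Local Notation V := {ffun 'I_n -> int}.
Import GRing.Theory.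

Definition burau_letter (a : letter (wb_gen n)) : V -> V :=
  match a with
  | (inl i, false) => burau (lstrand i) (rstrand i)
  | (inl i, true) => burauV (lstrand i) (rstrand i)
  | (inr i, _) => swap (lstrand i) (rstrand i)
  end.

Lemma burau_letterK a v : burau_letter a (burau_letter (inv_letter a) v) = v.
Proof.
by case: a => [[i|i] []];
  rewrite /= ?burauK ?burauVK ?swapK ?lstrand_neq_rstrand.
Qed.

Lemma burau_letter_rel u w : wb_rel u w ->
  forall v, foldr burau_letter v u = foldr burau_letter v w.
Proof.
have [disj adj] := (far_strands, consecutive_strands).
case=> {u w} [i j ij|i j ij|i|i j ij|i j ij|i j ij|i j ij|i j ij] v /=.
- by have [*] := disj _ _ _ ij; rewrite burau_burau_disjoint.
- by have [*] := adj _ _ _ ij; rewrite (rstrand_consecutive ij) burau_braid.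
- by rewrite swapK ?lstrand_neq_rstrand.
- by have [*] := disj _ _ _ ij; rewrite swap_swap_disjoint.
- by have [*] := adj _ _ _ ij; rewrite (rstrand_consecutive ij) swap_braid.
- by have [*] := disj _ _ _ ij; rewrite burau_swap_disjoint.
- by have [*] := adj _ _ _ ij; rewrite (rstrand_consecutive ij) swap_swap_burau.
by have [*] := adj _ _ _ ij; rewrite (rstrand_consecutive ij) swap_burau_burau.
Qed.

Definition rep : WB -> V -> V := pres_act burau_letter.

Lemma rep_class w v : rep (pres_class (@wb_rel n) w) v = foldr burau_letter v w.
Proof.
apply: pres_act_class; [exact: burau_letterK | exact: burau_letter_rel].
Qed.

Lemma rep1 v : rep 1 v = v.
Proof. apply: pres_act1; [exact: burau_letterK | exact: burau_letter_rel]. Qed.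

Lemma repM x y v : rep (x * y) v = rep x (rep y v).
Proof. apply: pres_actM; [exact: burau_letterK | exact: burau_letter_rel]. Qed.

Lemma repVK x v : rep x^-1 (rep x v) = v.
Proof. by rewrite -repM mulVg rep1. Qed.

Lemma repKV x v : rep x (rep x^-1 v) = v.
Proof. by rewrite -repM mulgV rep1. Qed.

Lemma burau_letter_linear a v w m :
  burau_letter a (v + w *+ m)%R = (burau_letter a v + burau_letter a w *+ m)%R.
Proof.
by case: a => [[i|i] []]; apply/ffunP => k; rewrite !(ffunE, ffunMnE);
  do 2?case: eqP => // _; ring.
Qed.

Lemma rep_linear x v w m : rep x (v + w *+ m)%R = (rep x v + rep x w *+ m)%R.
Proof.
rewrite /rep /pres_act; elim: (repr x) => //= a u ->.
exact: burau_letter_linear.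
Qed.

Definition congruence_subgroup (m : nat) : set WB :=
  [set x | forall v, exists w, rep x v = (v + w *+ m)%R].

Lemma congruence_normal m : normal_subgroup (congruence_subgroup m).
Proof.
split; first split.
- by move=> v; exists 0%R; rewrite rep1 mul0rn addr0.
- move=> x y Kx Ky v; rewrite repM.
  have [w] := Ky (rep y^-1 v); rewrite repKV => vE.
  have [w' ->] := Kx (rep y^-1 v); exists (w' - w)%R.
  by rewrite {2}vE mulrnBl addrACA addrA addrK.
move=> x y Kx v; rewrite !repM; have [w ->] := Kx (rep y v).
by exists (rep y^-1 w); rewrite rep_linear repVK.
Qed.

(** Writing x = 1 + m A and y = 1 + m B as operators, x y - y x is
    m ^ 2 (A B - B A). *)
Lemma congruenceR m x y : congruence_subgroup m x -> congruence_subgroup m y ->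
  congruence_subgroup (m * m) [~ x, y].
Proof.
move=> Kx Ky v.
suff [w xyE] : exists w, rep (x * y) v = (rep (y * x) v + w *+ (m * m))%R.
  exists (rep (y * x)^-1 w).
  have ->: [~ x, y] = (y * x)^-1 * (x * y) by rewrite [x * y]commgC mulKg.
  by rewrite repM xyE rep_linear repVK.
have [vx xE] := Kx v; have [vy yE] := Ky v.
have [vyx yxE] := Kx vy; have [vxy xyE] := Ky vx.
exists (vyx - vxy)%R; rewrite !repM yE xE !rep_linear xE yE yxE xyE.
by apply/ffunP=> k; rewrite !(ffunE, ffunMnE); ring.
Qed.

Lemma eqmod_congruence m x y :
  (forall v, exists w, rep y v = (rep x v + w *+ m)%R) ->
  eqmod (congruence_subgroup m) x y.
Proof.
move=> xy v; rewrite repM; have [w ->] := xy v.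
by exists (rep x^-1 w); rewrite rep_linear repVK.
Qed.

Lemma derived_congruence i : D i `<=` congruence_subgroup 2 ->
  forall k, D (k + i) `<=` congruence_subgroup (2 ^ 2 ^ k).
Proof.
move=> D2; elim=> [|k IH] //; rewrite expnS mul2n -addnn expnD.
apply: derivedS_min; first exact: (congruence_normal _).1.
by move=> x y /IH Kx /IH Ky; apply: congruenceR.
Qed.

Lemma congruence_tower_trivial x :
  (forall k, congruence_subgroup (2 ^ 2 ^ k) x) -> forall v, rep x v = v.
Proof.
move=> Kx v; apply/ffunP=> j.
have big k : (k < 2 ^ 2 ^ k)%N.
  by apply: ltn_trans (ltn_expl k _) (ltn_expl _ _).
(* The displacement d of the j-th entry is a multiple of 2 ^ 2 ^ d > d. *)
pose d := `|rep x v j - v j|%N; have [w xE] := Kx d v.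
have xj : rep x v j = (v j + w j *+ 2 ^ 2 ^ d)%R by rewrite xE !ffunE ffunMnE.
have dE : d = (`|w j| * 2 ^ 2 ^ d)%N.
  by rewrite {1}/d xj addrAC subrr add0r pmulrn -mulrzr intz abszM.
suff wj0 : w j = 0%R by rewrite xj wj0 mul0rn addr0.
by have := big d; nia.
Qed.

Lemma rep_sigma i v :
  rep (sigma_elt i) v = burau (lstrand i) (rstrand i) v.
Proof. exact: rep_class. Qed.

Lemma rep_rho i v : rep (rho_elt i) v = swap (lstrand i) (rstrand i) v.
Proof. exact: rep_class. Qed.

Lemma rep_sigmaV i v :
  rep (sigma_elt i)^-1 v = burauV (lstrand i) (rstrand i) v.
Proof. by rewrite pres_genV rep_class. Qed.

(** Modulo 2 the two kinds of generators act alike, by transposing entries. *)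
Lemma rep_mod2 (f : WB -> 'S_n) : {morph f : x y / x * y} ->
  (forall x, f (pres_gen (@wb_rel n) x) = strand_swap x) ->
  forall x v, exists w, rep x v = ([ffun j => v (f x j)] + w *+ 2)%R.
Proof.
move=> fM fgen x; move: x; apply: (generators_full (N := [set x | forall v,
  exists w, rep x v = ([ffun j => v (f x j)] + w *+ 2)%R])).
  split=> [v|x y Nx Ny v].
    exists 0%R; rewrite rep1 (morphM1 fM) mul0rn addr0.
    by apply/ffunP=> j; rewrite ffunE perm1.
  have [w vE] := Ny (rep y^-1 v); have [w' xE] := Nx (rep y^-1 v).
  (* Solving vE for rep y^-1 v reindexes the error term w by (f y)^-1. *)
  exists (w' - [ffun j => w ((f y)^-1%g (f x j))])%R.
  move: vE; rewrite repKV repM xE => vE; apply/ffunP=> j.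
  by rewrite {2}vE !(ffunE, ffunMnE) fM (morphMV fM) permM permKV; ring.
have rl i : rstrand i == lstrand i = false.
  by rewrite eq_sym (negPf (lstrand_neq_rstrand i)).
case=> [i|i] v; rewrite fgen /= /strand_tperm.
  exists [ffun j => if j == lstrand i then v (lstrand i) - v (rstrand i)
                    else 0]%R.
  rewrite [LHS]rep_sigma; apply/ffunP=> j; rewrite !(ffunE, ffunMnE).
  by case: tpermP => [->|->|/eqP/negPf-> /eqP/negPf->];
    rewrite ?eqxx ?rl; ring.
exists 0%R; rewrite mul0rn addr0 [LHS]rep_rho; apply/ffunP=> j; rewrite !ffunE.
by case: tpermP => [->|->|/eqP/negPf-> /eqP/negPf->]; rewrite ?eqxx ?rl.
Qed.

Lemma derived_sub_congruence2 :
  (n <= 4)%N -> exists i, D i `<=` congruence_subgroup 2.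
Proof.
move=> n_le4; have [f [fM fgen]] := exists_strand_perm n.
have [i Di1] := derived_solvable_quotient fM (Sym_solvable n_le4).
exists i => x /Di1 fx1 v; have [w ->] := rep_mod2 fM fgen x v; exists w.
by congr (_ + _)%R; apply/ffunP=> j; rewrite ffunE fx1 perm1.
Qed.

Section ModFive.
Variables i j : 'I_n.-1.
Hypothesis ij : consecutive i j.
Let s := sigma_elt i.
Let t := sigma_elt j.

(** For x and y the two conjugates of t^-1 * s in eqmod5_commg, the relation to
    be shown is y x (t^-1 s) = x y.  After cancellation these words are the
    conjugates by s of the two words below. *)
Lemma rep_mod5 v : exists w, rep (s^-1 * t^-1 * s * s * t^-1 * s) v =
  (rep (t^-1 * t^-1 * s * s * s * t^-1) v + w *+ 5)%R.
Proof.
have [pq pr qr] := consecutive_strands ij.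
rewrite !repM !rep_sigma !rep_sigmaV (rstrand_consecutive ij).
rewrite (coordsE (lstrand i) (lstrand j) (rstrand j) v).
move: (v (lstrand i)) (v (lstrand j)) (v (rstrand j)) => a b c.
(* The first word sends (a, b, c) to (2c - a, 3b + 6c - 8a, 2b + 5c - 6a), the
   second one to (4a - 3c, 6c - 3a - 2b, 10c - 6a - 3b). *)
exists (coords (lstrand i) (lstrand j) (rstrand j) (c - a) (b - a) (b - c) 0)%R.
rewrite !(burau_coords12, burau_coords23, burauV_coords12, burauV_coords23) //.
apply/ffunP=> k; rewrite !(ffunE, ffunMnE).
by do 3?case: eqP => _; ring.
Qed.

(** The image of t^-1 * s in SL_2(Z) has trace 3; modulo 5 this is -2, and the
    image is minus a unipotent matrix.  The sign matters: a commutator does not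
    see the signs of its entries, and in SL_2(F_5) the commutator of two
    unipotent matrices can be minus a nontrivial unipotent matrix, but not a
    nontrivial unipotent matrix.  The conjugators come from enumerating the 120
    elements of SL_2(F_5). *)
Lemma eqmod5_commg : eqmod (congruence_subgroup 5) (t^-1 * s)
  [~ (t^-1 * s) ^ (s * s), (t^-1 * s) ^ s].
Proof.
have nC := congruence_normal 5.
set x := _ ^ (s * s); set y := _ ^ s.
suff: eqmod (congruence_subgroup 5) (y * x * (t^-1 * s)) (x * y).
  by rewrite /eqmod [x * y]commgC invgM -mulgA mulKg.
have -> : y * x * (t^-1 * s) = (t^-1 * t^-1 * s * s * s * t^-1) ^ s.
  by rewrite /x /y /conjg !gnorm.
have -> : x * y = (s^-1 * t^-1 * s * s * t^-1 * s) ^ s.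
  by rewrite /x /y /conjg !gnorm.
exact/(eqmodJ nC)/eqmod_congruence/rep_mod5.
Qed.

Lemma notin_congruence5 : ~ congruence_subgroup 5 (t^-1 * s).
Proof.
have [pq pr qr] := consecutive_strands ij.
(* t^-1 * s sends the basis vector of the first strand to (2, 0, -1). *)
move=> /(_ [ffun k => (k == lstrand i)%:R%R]) [w /ffunP/(_ (lstrand i))].
rewrite repM rep_sigmaV rep_sigma !(ffunE, ffunMnE) (rstrand_consecutive ij).
rewrite !eqxx [lstrand j == lstrand i]eq_sym (negPf pq) (negPf pr); lia.
Qed.
End ModFive.

(** A stationary term of the derived series would act trivially, as it lies in
    all congruence_subgroup (2 ^ 2 ^ k), and nontrivially modulo 5. *)
Lemma derived_not_stable i : (3 <= n <= 4)%N -> ~ D i `<=` D i.+1.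
Proof.
case/andP=> n_ge3 n_le4 Dstable.
have [lt0 lt1] : (0 < n.-1)%N /\ (1 < n.-1)%N by split; lia.
have ij : consecutive (Ordinal lt0) (Ordinal lt1) by [].
have [x Dx sx] := derived_meets_coset (congruence_normal 5) (eqmod5_commg ij) i.
have [m Dm] := derived_sub_congruence2 n_le4.
have trivial_x : forall v, rep x v = v.
  apply: congruence_tower_trivial => k; apply: (derived_congruence Dm).
  apply: (@derived_anti _ _ (k + m + i)); first exact: leq_addr.
  exact: derived_stable Dx.
apply: (@notin_congruence5 _ _ ij).
have nC := congruence_normal 5; rewrite -[X in congruence_subgroup 5 X]invgK.
apply: (subgroupV nC.1); rewrite -[_^-1]mulg1.
apply: (eqmod_trans nC sx).
rewrite /eqmod mulg1; apply: (subgroupV nC.1) => v.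
by exists 0%R; rewrite mul0rn addr0.
Qed.
End BurauRepresentation.

Theorem corollary1p4 (n : nat) :
  ((5 <= n)%N -> adorable_of_degree (welded_braid n) 1) /\
  (n = 3 \/ n = 4 -> ~ adorable (welded_braid n)).
Proof.
split=> [n_ge5|n34 [i /trivial_quotientP]]; last first.
  by apply: derived_not_stable; case: n34 => ->.
split=> [|[/trivial_quotientP D01|//]].
  by apply/trivial_quotientP; apply: derived1_perfect.
by case: (@derived0_proper n) => //; lia.
Qed.
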